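(* Let $R$ be a ring, let $A$ be a subring retract of $R$, and let $\phi : R \to A$ be a module retraction map. 1) Assume that $\ker(\phi)$ is a torsion-free $A$-module. If $R$ is a Prüfer ring, then $A$ is a Prüfer ring. 2) Assume that $A$ is a local ring with maximal ideal $M$, that $A$ is a total ring of quotients, that $M\ker(\phi) = 0$, and that $\ker(\phi) \subseteq \mathrm{Nil}(R)$. Then $R$ is a total ring of quotients; in particular, $R$ is a Prüfer ring.
   Context: All rings are commutative with identity and all modules are unital. A local ring is a ring with a unique maximal ideal (not assumed Noetherian). $\mathrm{Nil}(R)$ is the set of nilpotent elements of $R$. Subring retract: for rings $A \subseteq R$ ($A$ a subring of $R$), $A$ is a subring retract (or module retract) of $R$ if there is an $A$-module homomorphism $\phi : R \to A$ with $\phi(a) = a$ for all $a \in A$ ($\phi$ need not be a ring homomorphism). Such a $\phi$ is called a module retraction map. An element of a ring is regular if it is not a zero-divisor; an ideal is regular if it contains a regular element. A ring is a Prüfer ring if every finitely generated regular ideal is invertible (in its total ring of quotients). A ring is a total ring of quotients if every element is either invertible or a zero-divisor. An $A$-module $E$ is torsion-free if for every regular element $a \in A$ and every $e \in E$ with $ae = 0$, one has $a = 0$ or $e = 0$. *)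

(* Defs.v *)
From HB Require Import structures.
From mathcomp Require Import all_boot all_algebra generic_quotient.
From mathcomp Require Import boolp classical_sets.
From mathcomp Require Import ring.

Set Implicit Arguments.
Unset Strict Implicit.
Unset Printing Implicit Defensive.

Import GRing.Theory.
Local Open Scope classical_set_scope.
Local Open Scope ring_scope.
Local Open Scope quotient_scope.

(* The commutative rings are comPzRingType's, so the zero ring is allowed. *)

Definition invertible_elt (R : comPzRingType) (x : R) : Prop :=
  exists y : R, x * y = 1.

Definition zero_divisor (R : comPzRingType) (x : R) : Prop :=
  exists2 y : R, y != 0 & x * y = 0.

Definition regular_elt (R : comPzRingType) (x : R) : Prop := ~ zero_divisor x.

Definition nilpotent_elt (R : comPzRingType) (x : R) : Prop :=
  exists n : nat, x ^+ n = 0.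

Definition total_quotient_ring (R : comPzRingType) : Prop :=
  forall x : R, invertible_elt x \/ zero_divisor x.

Lemma regular_eltP (R : comPzRingType) (x : R) :
  regular_elt x <-> forall y, x * y = 0 -> y = 0.
Proof.
split=> [rx y xy0|rx [y y0 /rx yE]]; last by rewrite yE eqxx in y0.
by apply/eqP/negPn/negP => y0; apply: rx; exists y.
Qed.

Lemma regular_elt1 (R : comPzRingType) : regular_elt (1 : R).
Proof. by apply/regular_eltP => y; rewrite mul1r. Qed.

Lemma regular_eltM (R : comPzRingType) (x y : R) :
  regular_elt x -> regular_elt y -> regular_elt (x * y).
Proof.
move=> /regular_eltP rx /regular_eltP ry; apply/regular_eltP => z.
by rewrite -mulrA => /rx /ry.
Qed.

Lemma regular_eltI (R : comPzRingType) (x : R) :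
  regular_elt x -> injective ( *%R x).
Proof.
move=> /regular_eltP rx y z /eqP; rewrite -subr_eq0 -mulrBr => /eqP /rx /eqP.
by rewrite subr_eq0 => /eqP.
Qed.

Section Submodules.
Variables (R : comPzRingType) (E : lmodType R).

Definition is_submodule (N : set E) : Prop :=
  N 0 /\ forall (a : R) (u v : E), N u -> N v -> N (a *: u + v).

Definition span_fin (n : nat) (g : 'I_n -> E) : set E :=
  [set x | exists c : 'I_n -> R, x = \sum_i c i *: g i].

(* The product I N: all finite sums of elements a *: u, a in I and u in N. *)
Definition ideal_smul (I : set R) (N : set E) : set E :=
  [set x | exists (n : nat) (a : 'I_n -> R) (u : 'I_n -> E),
     [/\ forall i, I (a i), forall i, N (u i) & x = \sum_i a i *: u i]].

Definition torsion_free (N : set E) : Prop :=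
  forall (a : R) (e : E), regular_elt a -> N e -> a *: e = 0 -> a = 0 \/ e = 0.

End Submodules.

Section Ideals.
Variable R : comPzRingType.

Definition is_ideal (I : set R) : Prop := is_submodule (I : set R^o).

Definition finitely_generated (I : set R) : Prop :=
  exists (n : nat) (g : 'I_n -> R), I = span_fin (g : 'I_n -> R^o).

Definition regular_ideal (I : set R) : Prop := exists2 x, I x & regular_elt x.

Definition maximal_ideal (M : set R) : Prop :=
  [/\ is_ideal M, M <> setT &
      forall J : set R, is_ideal J -> M `<=` J -> J = M \/ J = setT].

Definition local_ring_at (M : set R) : Prop :=
  maximal_ideal M /\ forall N : set R, maximal_ideal N -> N = M.

End Ideals.

(* Total ring of quotients: the localization of R at its regular elements,
   built as fraction.v builds the fraction field of an integral domain. *)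
Module TotalFrac.
Section TotalFrac.
Variable R : comPzRingType.

Inductive ratio := Ratio { frac :> R * R; _ : `[< regular_elt frac.2 >] }.

HB.instance Definition _ := [isSub for frac].
HB.instance Definition _ := [Choice of ratio by <:].

Lemma denP (x : ratio) : regular_elt (frac x).2.
Proof. by case: x => x /= /asboolP. Qed.

Arguments denP : clear implicits.

Definition mk (a s : R) (rs : regular_elt s) : ratio :=
  @Ratio (a, s) (asboolT rs).

Definition equivf (x y : ratio) : bool :=
  (frac x).1 * (frac y).2 == (frac y).1 * (frac x).2.

Lemma equivf_refl : reflexive equivf.
Proof. by move=> x; rewrite /equivf. Qed.

Lemma equivf_sym : symmetric equivf.
Proof. by move=> x y; rewrite /equivf eq_sym. Qed.

Lemma equivf_trans : transitive equivf.
Proof.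
move=> y x z /eqP xy /eqP yz; apply/eqP; apply: (regular_eltI (denP y)).
have -> : (frac y).2 * ((frac x).1 * (frac z).2)
        = ((frac x).1 * (frac y).2) * (frac z).2 by ring.
have -> : (frac y).2 * ((frac z).1 * (frac x).2)
        = ((frac z).1 * (frac y).2) * (frac x).2 by ring.
by rewrite xy -yz mulrAC.
Qed.

Canonical equivf_equiv := EquivRel equivf equivf_refl equivf_sym equivf_trans.

Definition type := {eq_quot equivf}.

HB.instance Definition _ : EqQuotient _ equivf type := EqQuotient.on type.
HB.instance Definition _ := Choice.on type.

Lemma pi_eq (x y : ratio) :
  (frac x).1 * (frac y).2 = (frac y).1 * (frac x).2 -> \pi_type x = \pi_type y.
Proof. by move=> xy; apply/eqmodP/eqP. Qed.

Lemma repr_eq (x : ratio) :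
  (frac (repr (\pi_type x))).1 * (frac x).2
    = (frac x).1 * (frac (repr (\pi_type x))).2.
Proof. by apply/eqP; rewrite -[_ == _]/(equivf _ _) -eqmodE reprK. Qed.

Definition addf (x y : ratio) : ratio :=
  mk ((frac x).1 * (frac y).2 + (frac y).1 * (frac x).2)
     (regular_eltM (denP x) (denP y)).
Definition oppf (x : ratio) : ratio := mk (- (frac x).1) (denP x).
Definition mulf (x y : ratio) : ratio :=
  mk ((frac x).1 * (frac y).1) (regular_eltM (denP x) (denP y)).

Definition fracmk (a s : R) (rs : regular_elt s) : type := \pi_type (mk a rs).
Definition totfrac (a : R) : type := fracmk a (@regular_elt1 R).

Definition add := lift_op2 type addf.
Definition opp := lift_op1 type oppf.
Definition mul := lift_op2 type mulf.

Lemma add_pi (x y : ratio) :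
  add (\pi_type x) (\pi_type y) = \pi_type (addf x y).
Proof.
unlock add; apply: pi_eq => /=; have ex := repr_eq x; have ey := repr_eq y.
set x' := repr (\pi_type x) in ex *; set y' := repr (\pi_type y) in ey *.
have -> : ((frac x').1 * (frac y').2 + (frac y').1 * (frac x').2)
            * ((frac x).2 * (frac y).2)
        = ((frac x').1 * (frac x).2) * ((frac y').2 * (frac y).2)
          + ((frac y').1 * (frac y).2) * ((frac x').2 * (frac x).2) by ring.
by rewrite ex ey; ring.
Qed.

Lemma opp_pi (x : ratio) : opp (\pi_type x) = \pi_type (oppf x).
Proof. by unlock opp; apply: pi_eq => /=; rewrite !mulNr repr_eq. Qed.

Lemma mul_pi (x y : ratio) :
  mul (\pi_type x) (\pi_type y) = \pi_type (mulf x y).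
Proof.
unlock mul; apply: pi_eq => /=; rewrite [LHS]mulrACA (repr_eq x) (repr_eq y).
exact: mulrACA.
Qed.

Lemma addA : associative add.
Proof.
elim/quotW=> x; elim/quotW=> y; elim/quotW=> z.
by rewrite !add_pi; apply: pi_eq => /=; ring.
Qed.

Lemma addC : commutative add.
Proof.
by elim/quotW=> x; elim/quotW=> y; rewrite !add_pi; apply: pi_eq => /=; ring.
Qed.

Lemma add0 : left_id (totfrac 0) add.
Proof. by elim/quotW=> x; rewrite add_pi; apply: pi_eq => /=; ring. Qed.

Lemma addN : left_inverse (totfrac 0) opp add.
Proof. by elim/quotW=> x; rewrite opp_pi add_pi; apply: pi_eq => /=; ring. Qed.

HB.instance Definition _ := GRing.isZmodule.Build type addA addC add0 addN.

Lemma mulA : associative mul.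
Proof.
elim/quotW=> x; elim/quotW=> y; elim/quotW=> z.
by rewrite !mul_pi; apply: pi_eq => /=; ring.
Qed.

Lemma mulC : commutative mul.
Proof.
by elim/quotW=> x; elim/quotW=> y; rewrite !mul_pi; apply: pi_eq => /=; ring.
Qed.

Lemma mul1 : left_id (totfrac 1) mul.
Proof. by elim/quotW=> x; rewrite mul_pi; apply: pi_eq => /=; ring. Qed.

Lemma mul_addl : left_distributive mul add.
Proof.
elim/quotW=> x; elim/quotW=> y; elim/quotW=> z.
by rewrite add_pi !mul_pi add_pi; apply: pi_eq => /=; ring.
Qed.

HB.instance Definition _ :=
  GRing.Zmodule_isComPzRing.Build type mulA mulC mul1 mul_addl.

Lemma totfrac_zmod_morphism : zmod_morphism totfrac.
Proof.
move=> a b; rewrite -[RHS]/(add _ (opp _)) opp_pi add_pi.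
by apply: pi_eq => /=; ring.
Qed.

HB.instance Definition _ :=
  GRing.isZmodMorphism.Build R type totfrac totfrac_zmod_morphism.

Lemma totfrac_monoid_morphism : monoid_morphism totfrac.
Proof.
split=> // a b; rewrite -[RHS]/(mul _ _) mul_pi.
by apply: pi_eq => /=; ring.
Qed.

HB.instance Definition _ :=
  GRing.isMonoidMorphism.Build R type totfrac totfrac_monoid_morphism.

Definition scale (a : R) (x : type) : type := totfrac a * x.

Lemma scaleA a b x : scale a (scale b x) = scale (a * b) x.
Proof. by rewrite /scale rmorphM mulrA. Qed.
Lemma scale1 : left_id 1 scale.
Proof. by move=> x; rewrite /scale rmorph1 mul1r. Qed.
Lemma scaleDr : right_distributive scale +%R.
Proof. by move=> a x y; rewrite /scale mulrDr. Qed.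
Lemma scaleDl x : {morph scale^~ x : a b / a + b}.
Proof. by move=> a b; rewrite /scale rmorphD mulrDl. Qed.

HB.instance Definition _ :=
  GRing.Zmodule_isLmodule.Build R type scaleA scale1 scaleDr scaleDl.

End TotalFrac.
End TotalFrac.
HB.export TotalFrac.

Arguments TotalFrac.type R%_type.
Notation total_frac := TotalFrac.type.
Notation totfrac := (@TotalFrac.totfrac _).

Lemma totfrac_inj (R : comPzRingType) : injective (@TotalFrac.totfrac R).
Proof. by move=> a b /eqmodP /eqP /=; rewrite !mulr1. Qed.

Lemma totfrac_unit (R : comPzRingType) (s : R) :
  regular_elt s -> invertible_elt (totfrac s).
Proof.
move=> rs; exists (TotalFrac.fracmk 1 rs).
rewrite -[LHS]/(TotalFrac.mul _ _) TotalFrac.mul_pi.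
by apply: TotalFrac.pi_eq => /=; ring.
Qed.

Lemma total_fracP (R : comPzRingType) (x : total_frac R) :
  exists a s : R, regular_elt s /\ totfrac s * x = totfrac a.
Proof.
elim/quotW: x => x; exists (TotalFrac.frac x).1, (TotalFrac.frac x).2.
split; first exact: TotalFrac.denP.
rewrite -[LHS]/(TotalFrac.mul _ _) TotalFrac.mul_pi.
by apply: TotalFrac.pi_eq => /=; ring.
Qed.

Section Prufer.
Variable R : comPzRingType.

(* I J = R inside the total ring of quotients, for some R-submodule J of it. *)
Definition invertible_ideal (I : set R) : Prop :=
  exists J : set (total_frac R),
    is_submodule J /\ ideal_smul I J = range (@TotalFrac.totfrac R).

Definition prufer_ring : Prop :=
  forall I : set R, is_ideal I -> finitely_generated I -> regular_ideal I ->
    invertible_ideal I.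

End Prufer.

(* R viewed as a module over its subring A, by restriction of scalars. *)
Definition over_subring (R : comPzRingType) (P : pred R)
  (A : subComPzRingType P) : Type := R.

Section OverSubring.
Variables (R : comPzRingType) (P : pred R) (A : subComPzRingType P).

HB.instance Definition _ := GRing.Zmodule.copy (over_subring A) R.

Definition subring_scale (a : A) (x : over_subring A) : over_subring A :=
  (val a * x : R).

Lemma subring_scaleA a b x :
  subring_scale a (subring_scale b x) = subring_scale (a * b) x.
Proof. by rewrite /subring_scale rmorphM mulrA. Qed.
Lemma subring_scale1 : left_id 1 subring_scale.
Proof. by move=> x; rewrite /subring_scale rmorph1 mul1r. Qed.
Lemma subring_scaleDr : right_distributive subring_scale +%R.
Proof. by move=> a x y; rewrite /subring_scale -mulrDr. Qed.
Lemma subring_scaleDl x : {morph subring_scale^~ x : a b / a + b}.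
Proof. by move=> a b; rewrite /subring_scale rmorphD mulrDl. Qed.

HB.instance Definition _ :=
  GRing.Zmodule_isLmodule.Build A (over_subring A)
    subring_scaleA subring_scale1 subring_scaleDr subring_scaleDl.

Definition module_retraction (phi : {linear over_subring A -> A^o}) : Prop :=
  forall a : A, phi (val a) = a.

Definition ker_set (phi : {linear over_subring A -> A^o}) :
  set (over_subring A) := [set x | phi x = 0].

End OverSubring.

(* Main.v *)
(* Part 1: if s is a regular element of an ideal I, then I is invertible iff
   s = sum_i g_i r_i with g_i in I and every r_i multiplies I into the principal
   ideal generated by s.  This divisibility condition lives inside the ring, so
   that a module retraction carries it from I R to I; torsion-freeness of the
   kernel keeps s regular in R.

   Part 2: write x = a + k with a = phi x and k in the kernel.  If a is a unit,
   so is x, a unit plus a nilpotent; if a = 0 then x is nilpotent; otherwise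
   a b = 0 with b nonzero and in M, so that b k = 0 and b x = 0. *)
Require Import Defs.
From mathcomp Require Import all_boot all_algebra.
From mathcomp Require Import boolp classical_sets.

Import GRing.Theory.
Local Open Scope classical_set_scope.
Local Open Scope ring_scope.

Lemma span_fin_submodule (R : comPzRingType) (E : lmodType R) (n : nat)
    (g : 'I_n -> E) : is_submodule (span_fin g).
Proof.
split; first by exists (fun=> 0); rewrite big1 // => i _; rewrite scale0r.
move=> a u v [c ->] [d ->]; exists (fun i => a * c i + d i).
rewrite scaler_sumr -big_split /=; apply: eq_bigr => i _.
by rewrite scalerDl scalerA.
Qed.

Lemma span_fin_gen (R : comPzRingType) (E : lmodType R) (n : nat)
    (g : 'I_n -> E) (i : 'I_n) : span_fin g (g i).
Proof.
exists (fun j => (j == i)%:R); rewrite (bigD1 i) //= eqxx scale1r big1 ?addr0 //.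
by move=> j /negPf ->; rewrite scale0r.
Qed.

(** If [I J = R], write 1 as a sum of [g i * u i] with [u i] in [J] and put [r i = s * u i], which
    lies in [R] because [s] is in [I]. Conversely, the fractions [r i / s] serve as the [u i]. *)
Lemma invertible_idealP (R : comPzRingType) (I : set R) (s : R) :
  I s -> regular_elt s ->
  invertible_ideal I <->
  exists (n : nat) (g r : 'I_n -> R),
    [/\ forall i, I (g i), s = \sum_i g i * r i &
        forall a i, I a -> exists t, a * r i = s * t].
Proof.
move=> Is rs; split.
- move=> [J [_ IJ]].
  have IJ_R a u : I a -> J u -> exists t, totfrac a * u = totfrac t.
    move=> Ia Ju; suff : ideal_smul I J (a *: u) by rewrite IJ => -[t _ tE]; exists t.
    by exists 1, (fun=> a), (fun=> u); split=> //; rewrite big_ord1.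
  have : ideal_smul I J 1 by rewrite IJ; exists 1 => //; rewrite rmorph1.
  move=> [n [g [u [Ig Ju one_sum]]]].
  have /choice [r ru] i : exists t, totfrac s * u i = totfrac t by apply: IJ_R.
  exists n, g, r; split=> // [|a i Ia].
    apply: totfrac_inj; rewrite rmorph_sum -[LHS]mulr1 one_sum mulr_sumr.
    apply: eq_bigr => i _.
    by rewrite rmorphM /= -ru -[_ *: _]/(totfrac _ * _) mulrCA.
  have [t aut] := IJ_R _ _ Ia (Ju i).
  by exists t; apply: totfrac_inj; rewrite !rmorphM /= -ru mulrCA aut.
- move=> [n [g [r [Ig sE dvd]]]].
  have [y sy] := totfrac_unit rs.
  (* The largest candidate for [J]: all fractions that multiply [I] into [R]. *)
  exists [set x | forall a, I a -> range (@TotalFrac.totfrac R) (totfrac a * x)].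
  split.
    split=> [a _|a u v Ju Jv b Ib]; first by exists 0; rewrite // rmorph0 mulr0.
    have [[t _ tE] [t' _ t'E]] := (Ju b Ib, Jv b Ib).
    exists (a * t + t') => //.
    by rewrite rmorphD rmorphM /= tE t'E mulrDr; congr (_ + _); rewrite mulrCA.
  apply/seteqP; split=> [x [m [a [u [Ia Ju ->]]]]|_ [z _ <-]].
    have /choice [t tE] i : exists t, totfrac t = totfrac (a i) * u i.
      by have [t _ tE] := Ju i _ (Ia i); exists t.
    exists (\sum_i t i) => //; rewrite rmorph_sum; apply: eq_bigr => i _.
    exact: tE.
  (* Here [y] is [1 / s], so [z] is expanded as the sum of [g i * (z * r i / s)]. *)
  exists n, g, (fun i => totfrac (z * r i) * y); split=> // [i a Ia|].
    have [t at_] := dvd a i Ia; exists (z * t) => //.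
    have azr : a * (z * r i) = s * (z * t) by rewrite mulrCA at_ mulrCA.
    by rewrite mulrA -rmorphM azr (rmorphM totfrac s) mulrAC sy mul1r.
  transitivity (totfrac z * (totfrac s * y)); first by rewrite sy mulr1.
  rewrite sE rmorph_sum mulr_suml mulr_sumr; apply: eq_bigr => i _.
  rewrite -[_ *: _]/(totfrac _ * _) !rmorphM !mulrA; congr (_ * _ * _).
  by rewrite mulrC.
Qed.

(** A regular element [s] of [I] is a unit here, so the one-term expression [s = s * 1] meets the
    divisibility criterion. *)
Lemma total_quotient_prufer (R : comPzRingType) :
  total_quotient_ring R -> prufer_ring R.
Proof.
move=> tqR I _ _ [s Is rs]; apply/(invertible_idealP _ _ _ Is rs).
have [[y sy]|//] := tqR s.
exists 1, (fun=> s), (fun=> 1); split=> // [|a _ _].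
  by rewrite big_ord1 mulr1.
by exists (y * a); rewrite mulr1 mulrA sy mul1r.
Qed.

Lemma maximal_ideal_above (R : comPzRingType) (b : R) :
  ~ invertible_elt b -> exists2 N : set R, maximal_ideal N & N b.
Proof.
move=> bNunit.
(* 0 and b are required only in nonempty sets, so that the empty chain has a union. *)
pose Pr : set (set R) := [set J |
  [/\ forall a u v : R, J u -> J v -> J (a * u + v),
      J !=set0 -> J 0 /\ J b & ~ J 1]].
have [N [[NL Nne N1] Nmax]] : exists N, Pr N /\ forall B, N `<` B -> ~ Pr B.
  apply: Zorn_bigcup => F F_Pr F_tot; split.
  - move=> a u v [X FX Xu] [Y FY Yv].
    have [XY|YX] := F_tot _ _ FX FY.
      by exists Y => //; have [YL _ _] := F_Pr _ FY; apply: YL => //; apply: XY.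
    by exists X => //; have [XL _ _] := F_Pr _ FX; apply: XL => //; apply: YX.
  - move=> [x [X FX Xx]]; have [_ Xne _] := F_Pr _ FX.
    by have [X0 Xb] := Xne (ex_intro _ x Xx); split; exists X.
  - by move=> [X FX X1]; have [_ _] := F_Pr _ FX; apply.
have N_nonempty : N !=set0.
  apply/set0P/negP => /eqP N0.
  (* The principal ideal of [b] is proper, as [b] is not a unit, and it strictly contains the empty
     set; so the empty set is not maximal in [Pr]. *)
  apply: (Nmax [set x | exists c, x = c * b]).
    split=> [|sub]; first by rewrite N0.
    have : N b by apply: sub; exists 1; rewrite mul1r.
    by rewrite N0.
  split.
  - move=> a _ _ [c ->] [d ->]; exists (a * c + d).
    by rewrite mulrDl mulrA.
  - by move=> _; split; [exists 0; rewrite mul0r|exists 1; rewrite mul1r].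
  - by move=> [c cb]; apply: bNunit; exists c; rewrite mulrC.
have [N0 Nb] := Nne N_nonempty.
exists N => //; split; first by split.
  by move=> NT; apply: N1; rewrite NT.
move=> J [J0 JL] NJ; have [->|JN] := pselect (J = N); [by left|right].
have J1 : J 1.
  apply: contrapT => J1; apply: (Nmax J).
    by split=> // JsubN; apply: JN; apply/seteqP.
  by split=> // _; split=> //; apply: NJ.
by apply/seteqP; split=> // x _; rewrite -[x]mulr1 -[_ * _]addr0; apply: JL.
Qed.

Lemma local_nonunit (R : comPzRingType) (M : set R) (b : R) :
  local_ring_at M -> ~ invertible_elt b -> M b.
Proof. by move=> [_ Muniq] /maximal_ideal_above [N /Muniq ->]. Qed.

(** The last nonzero power of [x] is killed by [x]; it exists because [x ^+ 0 = 1] is nonzero. *)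
Lemma nilpotent_zero_divisor (R : comPzRingType) (x : R) :
  1 != 0 :> R -> nilpotent_elt x -> zero_divisor x.
Proof.
move=> oneN0 [n]; elim: n => [|n IHn] xn; first by rewrite -xn expr0 eqxx in oneN0.
have [/IHn //|xnN0] := eqVneq (x ^+ n) 0.
by exists (x ^+ n) => //; rewrite -exprS.
Qed.

(** [u + k] divides [u ^+ n - (- k) ^+ n], which is the unit [u ^+ n] once [k ^+ n = 0]. *)
Lemma unit_add_nilpotent (R : comPzRingType) (u k : R) :
  invertible_elt u -> nilpotent_elt k -> invertible_elt (u + k).
Proof.
move=> [v uv] [n kn].
have [z zE] : exists z, u ^+ n - (- k) ^+ n = (u + k) * z.
  by rewrite subrXX opprK; eexists.
exists (z * v ^+ n).
by rewrite mulrA -zE exprNn kn mulr0 subr0 -exprMn uv expr1n.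
Qed.

Section Retract.
Variables (R : comPzRingType) (P : pred R) (A : subComPzRingType P).
Variables (phi : {linear over_subring A -> A^o}).
Hypothesis phi_retr : module_retraction phi.

Lemma retraction_valM (a : A) (x : R) : phi (val a * x : R) = a * phi x.
Proof. exact: (linearZZ phi a (x : over_subring A)). Qed.

Lemma retraction_ker (x : R) : ker_set phi (x - val (phi x : A)).
Proof.
by apply: etrans (raddfB phi _ _) _; rewrite [X in _ - X]phi_retr subrr.
Qed.

(** Applying [phi] to [s y = 0] gives [s * phi y = 0], so [y] is in the kernel, where
    torsion-freeness applies. *)
Lemma regular_val (s : A) :
  torsion_free (ker_set phi) -> regular_elt s -> regular_elt (val s : R).
Proof.
move=> tf rs; apply/regular_eltP => y sy.
have /regular_eltP rs' := rs.
have ky : ker_set phi y.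
  by apply: rs'; rewrite -retraction_valM sy; apply: (raddf0 phi).
have [s0|//] := tf s y rs ky sy.
(* Zero is regular only in the zero ring, and then [R] is zero as well. *)
have one0 : 1 = 0 :> A by apply: rs'; rewrite s0 mul0r.
by rewrite -[y]mul1r -(rmorph1 (val : A -> R)) one0 rmorph0 mul0r.
Qed.

Lemma retract_prufer :
  torsion_free (ker_set phi) -> prufer_ring R -> prufer_ring A.
Proof.
move=> tf prufR I idI [n [g IE]] [s Is rs].
have rvs := regular_val _ tf rs.
pose IR : set R := span_fin ((fun i => val (g i)) : 'I_n -> R^o).
have val_IR a : I a -> IR (val a).
  rewrite IE => -[c ->]; exists (fun i => val (c i)).
  by rewrite rmorph_sum; apply: eq_bigr => i _; rewrite -[RHS]rmorphM.
have IRs := val_IR _ Is.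
have : invertible_ideal IR.
  apply: prufR; first exact: span_fin_submodule.
    by exists n, (fun i => val (g i)).
  by exists (val s).
move=> /(invertible_idealP _ _ _ IRs rvs) [m [h [r [IRh sE dvd]]]].
have /choice [c hE] : forall k, exists c : 'I_n -> R, h k = \sum_i c i * val (g i).
  exact: IRh.
(* Regrouping along the generators of [I] turns [s = \sum_k h k * r k] into [s = \sum_i g i * q i].
   The left factors now lie in [A], so [phi] can be applied termwise. *)
pose q i : R := \sum_k c k i * r k.
apply/(invertible_idealP _ _ _ Is rs).
exists n, g, (fun i => phi (q i)); split=> [i||a i Ia].
- by rewrite IE; exact: (span_fin_gen A A^o).
- rewrite -[LHS]phi_retr sE.
  have -> : \sum_k h k * r k = \sum_i val (g i) * q i.
    under eq_bigr => k _ do rewrite hE mulr_suml.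
    rewrite exchange_big; apply: eq_bigr => i _; rewrite mulr_sumr.
    by apply: eq_bigr => k _; rewrite mulrAC mulrC.
  rewrite (raddf_sum phi); apply: eq_bigr => i _; exact: retraction_valM.
- have /choice [t tE] k : exists t, val a * r k = val s * t.
    by apply: dvd; apply: val_IR.
  exists (phi (\sum_k c k i * t k : R)).
  rewrite -!retraction_valM; congr (phi _); rewrite !mulr_sumr.
  by apply: eq_bigr => k _; rewrite mulrCA tE mulrCA.
Qed.

Lemma retract_total_quotient (M : set A) :
  local_ring_at M -> total_quotient_ring A ->
  ideal_smul M (ker_set phi) = [set 0] ->
  ker_set phi `<=` [set x | nilpotent_elt (x : R)] ->
  total_quotient_ring R.
Proof.
move=> locM tqA MK nilK x.
pose a : A := phi x; pose k : R := x - val a.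
have xE : x = val a + k by rewrite /k addrC subrK.
have kerk : ker_set phi k := retraction_ker x.
have [[v av]|[b bN0 ab]] := tqA a.
  left; rewrite xE; apply: unit_add_nilpotent; last exact: nilK.
  by exists (val v); rewrite -rmorphM av rmorph1.
right.
have vbN0 : val b != 0 :> R by rewrite -(rmorph0 (val : A -> R)) (inj_eq val_inj).
have [a0|aN0] := eqVneq a 0.
  apply: nilpotent_zero_divisor; last by rewrite xE a0 rmorph0 add0r; apply: nilK.
  (* The nonzero element [val b] shows that [R] is not the zero ring. *)
  by apply: contraNneq vbN0 => one0; rewrite -[val b]mul1r one0 mul0r.
(* If [b] were a unit, [a b = 0] would force [a = 0]. *)
have Mb : M b.
  apply: local_nonunit => // -[v bv].
  by case/eqP: aN0; rewrite -[a]mulr1 -bv mulrA ab mul0r.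
have bk : val b * k = 0.
  have : ideal_smul M (ker_set phi) (b *: (k : over_subring A)).
    by exists 1, (fun=> b), (fun=> k); split=> //; rewrite big_ord1.
  by rewrite MK.
exists (val b) => //.
by rewrite xE mulrC mulrDr bk addr0 -rmorphM mulrC ab rmorph0.
Qed.

End Retract.

Theorem theorem2p2 (R : comPzRingType) (P : pred R) (A : subComPzRingType P)
    (phi : {linear over_subring A -> A^o}) (phi_retr : module_retraction phi) :
  (torsion_free (ker_set phi) -> prufer_ring R -> prufer_ring A)
  /\
  (forall M : set A,
     local_ring_at M ->
     total_quotient_ring A ->
     ideal_smul M (ker_set phi) = [set 0] ->
     ker_set phi `<=` [set x | nilpotent_elt (x : R)] ->
     total_quotient_ring R /\ prufer_ring R).
Proof.
split; first exact: retract_prufer.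
move=> M locM tqA MK nilK.
have tqR := retract_total_quotient _ _ _ _ phi_retr _ locM tqA MK nilK.
by split=> //; apply: total_quotient_prufer.
Qed.
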